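(* Let $n\ge 3$ be an integer, let $i\in\{2,\ldots,n-1\}$, and let $S_i=[n-i]=\{1,2,\ldots,n-i\}$. Then \[\max\{d_\ell(\sigma,\rho):\sigma,\rho\in\mathcal{D}(S_i;n),\ \sigma\ne\rho\}=\max\{i-1,\,n-i\}.\]
   Context: $S_n$ is the symmetric group on $[n]=\{1,\ldots,n\}$, with permutations in one-line notation $\sigma=\sigma_1\cdots\sigma_n$. The descent set of $\sigma$ is $\mathcal{D}(\sigma)=\{j\in[n-1]:\sigma_j>\sigma_{j+1}\}$, and for $S\subseteq[n-1]$, $\mathcal{D}(S;n)=\{\sigma\in S_n:\mathcal{D}(\sigma)=S\}$. The $\ell_\infty$-metric is $d_\ell(\sigma,\rho)=\max\{|\sigma_j-\rho_j|:1\le j\le n\}$. *)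

(* Defs.v *)
From mathcomp Require Import all_boot all_order all_fingroup all_algebra.
Set Implicit Arguments.
Unset Strict Implicit.
Unset Printing Implicit Defensive.

(* Positions and values are 0-based: sigma_j is (s j' + 1) with j' = j - 1,
   and the element j of [n-1] is the ordinal of value j - 1 in 'I_n.-1. *)

Lemma succ_ord_proof (n : nat) (j : 'I_n.-1) : j.+1 < n.
Proof. by case: n j => [|n] [j lt_jn]. Qed.

Definition pos_cur (n : nat) (j : 'I_n.-1) : 'I_n := widen_ord (leq_pred n) j.

Definition pos_next (n : nat) (j : 'I_n.-1) : 'I_n := Ordinal (succ_ord_proof j).

Definition descent_set (n : nat) (s : 'S_n) : {set 'I_n.-1} :=
  [set j : 'I_n.-1 | s (pos_next j) < s (pos_cur j)].

Definition perms_with_descents (n : nat) (S : {set 'I_n.-1}) : {set 'S_n} :=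
  [set s : 'S_n | descent_set s == S].

(* [m] = {1, ..., m} as a subset of [n-1], in the 0-based indexing above. *)
Definition initial_segment (n m : nat) : {set 'I_n.-1} :=
  [set j : 'I_n.-1 | j < m].

Definition linf_dist (n : nat) (s r : 'S_n) : nat :=
  \max_(j < n) `|s j - r j|%N.

(* Main.v *)
Require Import Defs.
From mathcomp Require Import all_boot all_order all_fingroup all_algebra.
From mathcomp Require Import zify.

Set Implicit Arguments.
Unset Strict Implicit.
Unset Printing Implicit Defensive.

(** Put [m = n - i], with positions and values counted from 0. A permutation
    with descent set [initial_segment n m] decreases strictly up to position
    [m] and increases strictly afterwards, so the value at position [j <= m]
    lies in [[m - j, n - 1 - j]] and the value at position [j >= m] lies in
    [[j - m, j]]. These intervals have lengths [i - 1] and [n - i], which is the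
    upper bound. The two permutations attaining all lower ends on one side of
    [m] and all upper ends on the other differ by [i - 1] at position 0 and by
    [n - i] at position [n - 1]. *)

Section ValleyPermutations.

Variables (n m : nat).
Implicit Types (s : 'S_n) (j k : 'I_n).

(** Taking any two ordinals with [k = j.+1] keeps [pos_cur] and [pos_next] out of the inductions
    below. *)
Lemma descentE s j k : s \in perms_with_descents (initial_segment n m) ->
  k = j.+1 :> nat -> (s k < s j) = (j < m).
Proof.
rewrite inE => /eqP/setP hs kE.
have lt_j : j < n.-1 by have := ltn_ord k; lia.
have := hs (Ordinal lt_j); rewrite !inE /=.
by congr ((s _ < s _) = _); apply: val_inj.
Qed.

(** Each of the [k - j] unit steps is a descent and lowers the value by at least 1. *)
Lemma descent_decreasing s j k : s \in perms_with_descents (initial_segment n m) ->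
  j <= k <= m -> s k + (k - j) <= s j.
Proof.
move=> hs; move: {2}(k - j) (leqnn (k - j)) => d.
elim: d k => [|d IHd] k hd jkm.
  have -> : k = j by apply: ord_inj; lia.
  by rewrite subnn addn0.
have [lt_jk|le_kj] := ltnP j k; last first.
  have -> : k = j by apply: ord_inj; lia.
  by rewrite subnn addn0.
have lt_k : k.-1 < n by have := ltn_ord k; lia.
have := IHd (Ordinal lt_k); have := @descentE s (Ordinal lt_k) k hs; simpl; lia.
Qed.

Lemma ascent_increasing s j k : s \in perms_with_descents (initial_segment n m) ->
  m <= j <= k -> s j + (k - j) <= s k.
Proof.
move=> hs; move: {2}(k - j) (leqnn (k - j)) => d.
elim: d k => [|d IHd] k hd mjk.
  have -> : k = j by apply: ord_inj; lia.
  by rewrite subnn addn0.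
have [lt_jk|le_kj] := ltnP j k; last first.
  have -> : k = j by apply: ord_inj; lia.
  by rewrite subnn addn0.
have lt_k : k.-1 < n by have := ltn_ord k; lia.
(* The absence of a descent gives only a weak inequality; injectivity of [s] makes it strict. *)
have neq_s : s (Ordinal lt_k) <> s k :> nat.
  by move=> /val_inj/perm_inj/(congr1 val) /=; lia.
have := IHd (Ordinal lt_k); have := @descentE s (Ordinal lt_k) k hs; simpl; lia.
Qed.

(** The lower bound compares [j] with position [m], whose value is at least 0; the upper one
    compares it with position 0, whose value is at most [n.-1]. *)
Lemma left_value_bounds s j : m < n ->
  s \in perms_with_descents (initial_segment n m) ->
  j <= m -> m - j <= s j <= n.-1 - j.
Proof.
move=> lt_mn hs jm; have lt0n : 0 < n by lia.
have := @descent_decreasing s j (Ordinal lt_mn) hs.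
have := @descent_decreasing s (Ordinal lt0n) j hs.
have := ltn_ord (s (Ordinal lt0n)); simpl; lia.
Qed.

(** Here the comparison is with positions [m] and [n.-1]. *)
Lemma right_value_bounds s j : m < n ->
  s \in perms_with_descents (initial_segment n m) ->
  m <= j -> j - m <= s j <= j.
Proof.
move=> lt_mn hs mj; have lt_last : n.-1 < n by lia.
have := @ascent_increasing s (Ordinal lt_mn) j hs.
have := @ascent_increasing s j (Ordinal lt_last) hs.
have := ltn_ord (s (Ordinal lt_last)); have := ltn_ord j; simpl; lia.
Qed.

Lemma linf_dist_le s r : m < n ->
  s \in perms_with_descents (initial_segment n m) ->
  r \in perms_with_descents (initial_segment n m) ->
  linf_dist s r <= maxn (n.-1 - m) m.
Proof.
move=> lt_mn hs hr; apply/bigmax_leqP => j _.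
have [jm|/ltnW mj] := leqP j m.
- have := left_value_bounds lt_mn hs jm; have := left_value_bounds lt_mn hr jm; lia.
- have := right_value_bounds lt_mn hs mj; have := right_value_bounds lt_mn hr mj; lia.
Qed.

Lemma exists_perm_of_nat (f : nat -> nat) :
  (forall a, a < n -> f a < n) ->
  {in gtn n &, injective f} ->
  exists s, forall j, s j = f j :> nat.
Proof.
move=> f_lt f_inj; pose g j := Ordinal (f_lt j (ltn_ord j)).
have g_inj : injective g.
  by move=> j k /(congr1 val) /= e; apply/ord_inj/f_inj; rewrite ?inE ?ltn_ord.
by exists (perm g_inj) => j; rewrite permE.
Qed.

(** The values in order are [m, ..., 0, m + 1, ..., n - 1]. *)
Lemma low_left_perm_exists :
  m < n ->
  exists2 s, s \in perms_with_descents (initial_segment n m)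
    & forall j, s j = (if j <= m then m - j else j) :> nat.
Proof.
move=> lt_mn; case: (@exists_perm_of_nat (fun a => if a <= m then m - a else a)).
- by move=> a; case: ifP; lia.
- by move=> a b; rewrite !inE; do 2 case: ifP; lia.
move=> s sE; exists s => //.
by rewrite inE; apply/eqP/setP => j; rewrite !inE !sE /=; do 2 case: ifP; lia.
Qed.

(** The values in order are [n - 1, ..., n - m, 0, ..., n - 1 - m]. *)
Lemma high_left_perm_exists :
  m < n ->
  exists2 s, s \in perms_with_descents (initial_segment n m)
    & forall j, s j = (if j < m then n.-1 - j else j - m) :> nat.
Proof.
move=> lt_mn; case: (@exists_perm_of_nat (fun a => if a < m then n.-1 - a else a - m)).
- by move=> a; case: ifP; lia.
- by move=> a b; rewrite !inE; do 2 case: ifP; lia.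
move=> s sE; exists s => //.
rewrite inE; apply/eqP/setP => j; rewrite !inE !sE /=.
by have := ltn_ord j; do 2 case: ifP; lia.
Qed.

End ValleyPermutations.

Theorem theorem4p1 (n i : nat) (hn : 3 <= n) (hi : 2 <= i <= n - 1) :
  \max_(s in perms_with_descents (initial_segment n (n - i)))
    \max_(r in perms_with_descents (initial_segment n (n - i)) | s != r)
      linf_dist s r
  = maxn (i - 1) (n - i).
Proof.
have lt_mn : n - i < n by lia.
apply/anti_leq/andP; split.
  apply/bigmax_leqP => s hs; apply/bigmax_leqP => r /andP[hr _].
  by apply: leq_trans (linf_dist_le lt_mn hs hr) _; lia.
have [s hs sE] := low_left_perm_exists lt_mn.
have [r hr rE] := high_left_perm_exists lt_mn.
have lt0n : 0 < n by lia.
have lt_last : n.-1 < n by lia.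
(* At position 0 the values are [n - i] and [n - 1], which differ because [i >= 2]. *)
have neq_sr : s != r.
  apply/eqP => e; have := sE (Ordinal lt0n); rewrite e rE /=; do ?case: ifP; lia.
apply: (bigmax_sup s) => //; apply: (bigmax_sup r); first by rewrite hr.
rewrite geq_max; apply/andP; split.
- by apply: (bigmax_sup (Ordinal lt0n)); rewrite // sE rE /=; do ?case: ifP; lia.
- by apply: (bigmax_sup (Ordinal lt_last)); rewrite // sE rE /=; do ?case: ifP; lia.
Qed.
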